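(* Let $A\in\mathbb C^{2\times2}$ be diagonalizable with eigenvalues $\alpha$ and $\lambda$, where $\alpha>0$ and $|\lambda|<\alpha$. Let $r$ and $\ell$ be right and left $\alpha$-eigenvectors of $A$ (i.e. $Ar=\alpha r$, $\ell^{\mathsf T}A=\alpha\ell^{\mathsf T}$) with $\ell^{\mathsf T}r\neq0$, and fix any matrix norm $\|\cdot\|$ on $\mathbb C^{2\times2}$. (1) Let $(A_n)_{n\ge0}$ be a sequence in $\mathbb C^{2\times 2}$, write $A_n=A+E_n$, and suppose that $$\sum_{n\ge0}\|E_n\|^2<\infty\qquad\text{and}\qquad\sum_{n\ge0}\ell^{\mathsf T}E_nr\ \text{ converges}$$ (not necessarily absolutely). Then the normalized products $\alpha^{-N}A_{N-1}\cdots A_0$ converge in $\mathbb C^{2\times2}$ as $N\to\infty$. (2) Suppose now that $A_n=A_n(t)$ depends continuously on $t\in\mathbb R$ for each $n\ge0$, and write $E_n(t)=A_n(t)-A$. If, for every $T>0$, $$\sum_{n\ge0}\ \sup_{|t|\le T}\|E_n(t)\|^2<\infty$$ and $\sum_{n\ge0}\ell^{\mathsf T}E_n(t)r$ converges uniformly for $|t|\le T$, then the normalized products $\alpha^{-N}A_{N-1}(t)\cdots A_0(t)$ converge locally uniformly in $t$ as $N\to\infty$, and the limiting matrix is continuous in $t$.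
   Context: All vectors are column vectors in $\mathbb C^2$; $\ell^{\mathsf T}$ denotes the (non-conjugated) transpose. *)

(* Defs.v *)
From HB Require Import structures.
From mathcomp Require Import all_boot all_order all_algebra.
From mathcomp Require Import all_classical all_reals all_analysis.
From mathcomp Require Import complex.

Set Implicit Arguments.
Unset Strict Implicit.
Unset Printing Implicit Defensive.

Import Order.TTheory GRing.Theory Num.Theory.
Import numFieldNormedType.Exports.

Local Open Scope ring_scope.
Local Open Scope complex_scope.
Local Open Scope classical_set_scope.

(* [R[i]] has no topology in the libraries.  As for any [numFieldType], it is
   the one induced by the modulus, already available on the alias [R[i]^o]. *)
HB.instance Definition _ (R : realType) := GRing.ComAlgebra.copy R[i] R[i]^o.
HB.instance Definition _ (R : realType) := Vector.copy R[i] R[i]^o.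
HB.instance Definition _ (R : realType) := NormedModule.copy R[i] R[i]^o.

(* A norm on the complex vector space of matrices; submultiplicativity is not
   required.  The modulus of [R[i]] takes its values in [R[i]], hence the
   casts in [mxnormZ]. *)
Record matrix_norm (R : realType) (m n : nat)
    (nu : 'M[R[i]]_(m, n) -> R) : Prop := MatrixNorm {
  mxnorm_ge0 : forall M, 0 <= nu M;
  mxnorm_eq0 : forall M, nu M = 0 -> M = 0;
  mxnormD : forall M M', nu (M + M') <= nu M + nu M';
  mxnormZ : forall (c : R[i]) M, (nu (c *: M))%:C = `|c| * (nu M)%:C
}.

(* [leftprod B N = B (N - 1) *m ... *m B 0]: later factors act on the left. *)
Fixpoint leftprod (K : pzRingType) (d : nat) (B : nat -> 'M[K]_d) (N : nat) :
    'M[K]_d :=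
  if N is N'.+1 then B N' *m leftprod B N' else 1%:M.

Definition normalized_prod (R : realType) (d : nat) (alpha : R)
    (B : nat -> 'M[R[i]]_d) (N : nat) : 'M[R[i]]_d :=
  (alpha%:C ^- N) *: leftprod B N.

Definition cvg_uniformly_on (U : choiceType) (V : uniformType) (D : set U)
    (f : nat -> U -> V) : Prop :=
  exists g : U -> V, {uniform D, f @ \oo --> g}.

Definition cvg_locally_uniformly_to (U : topologicalType) (V : uniformType)
    (f : nat -> U -> V) (g : U -> V) : Prop :=
  forall x : U, exists2 W : set U, nbhs x W & {uniform W, f @ \oo --> g}.

(* Main.v *)
(** In coordinates adapted to the left eigenvectors the normalized recursion reads
    [x' = (1 + a) x + b y], [y' = c x + (lambda / alpha + d) y], where [a], [b],
    [c], [d] are square summable and [a], a multiple of [l^T E r], has convergent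
    partial sums [S]. Passing to [u = exp (- S) x] turns [1 + a] into
    [(1 + a) exp (- a) = 1 + O(a^2)]. The moduli of [u] and [y] are then dominated by
    the scalar recursion [P' = (1 + e^2) P + e Q], [Q' = e P + (m + e) Q] with [m < 1]
    and [e] square summable, for which [P^2 + Q^2 + eta * sum Q^2] stays bounded:
    [P] is nondecreasing and bounded, [Q] tends to [0], and the increments of [u] are
    at most those of [P]. Since [P] and [Q] do not depend on the parameter [t], all
    the estimates are uniform in [t]; a constant family gives the first part. *)

Require Import Defs.
From HB Require Import structures.
From mathcomp Require Import all_boot all_order all_algebra.
From mathcomp Require Import all_classical all_reals all_analysis.
From mathcomp Require Import complex ring lra.

Set Implicit Arguments.
Unset Strict Implicit.
Unset Printing Implicit Defensive.

Import Order.TTheory GRing.Theory Num.Theory.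
Import numFieldNormedType.Exports.

Local Open Scope ring_scope.
Local Open Scope complex_scope.
Local Open Scope classical_set_scope.

Notation normc := Normc.normc.

(** * Modulus of a complex number with values in the real field *)

Lemma normr_normc (R : rcfType) (z : R[i]) : `|z| = (normc z)%:C.
Proof. by []. Qed.

Lemma normc_ge0 (R : rcfType) (z : R[i]) : 0 <= normc z.
Proof. by case: z => a b; exact: sqrtr_ge0. Qed.

Lemma normcB (R : rcfType) (z w : R[i]) : normc (z - w) = normc (w - z).
Proof. by rewrite -normcN opprB. Qed.

Lemma ler_normcB (R : rcfType) (z w : R[i]) : normc (z - w) <= normc z + normc w.
Proof. by rewrite -[normc w]normcN le_normcD. Qed.

Lemma normc_real (R : rcfType) (x : R) : normc x%:C = `|x|.
Proof. by rewrite /= expr0n addr0 sqrtr_sqr. Qed.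

Lemma ler_Re_normc (R : rcfType) (z : R[i]) : `|complex.Re z| <= normc z.
Proof.
by case: z => a b /=; rewrite -sqrtr_sqr ler_wsqrtr // lerDl sqr_ge0.
Qed.

Lemma ler_Im_normc (R : rcfType) (z : R[i]) : `|complex.Im z| <= normc z.
Proof.
by case: z => a b /=; rewrite -sqrtr_sqr ler_wsqrtr // lerDr sqr_ge0.
Qed.

Lemma normc_le_ReIm (R : rcfType) (z : R[i]) :
  normc z <= `|complex.Re z| + `|complex.Im z|.
Proof.
case: z => a b /=; rewrite -[leRHS]ger0_norm ?addr_ge0 // -[leRHS]sqrtr_sqr.
rewrite ler_wsqrtr // sqrrD !real_normK ?num_real //.
by rewrite -addrA lerD2l lerDr mulrn_wge0 // mulr_ge0.
Qed.

Lemma ler_normc_sum (R : rcfType) (I : Type) (s : seq I) (f : I -> R[i]) :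
  normc (\sum_(i <- s) f i) <= \sum_(i <- s) normc (f i).
Proof.
elim/big_ind2: _ => // [|z x w y zx wy]; first by rewrite Normc.normc0.
by rewrite (le_trans (le_normcD _ _)) // lerD.
Qed.

(** * Elementary bounds for the real exponential, sine and cosine *)

Lemma norm_expR_sub1 (R : realType) (x : R) : `|expR x - 1| <= `|x| * expR `|x|.
Proof.
have h := @expR_ge1Dx R x; have h' := @expR_ge1Dx R (- x).
have e0 := expR_gt0 x; have ee : expR (- x) * expR x = 1.
  by rewrite -expRD addNr expR0.
(* For [x >= 0], multiplying [1 - x <= expR (- x)] by [expR x] gives [(1 - x) * expR x <= 1]. *)
have [x0|x0] := leP 0 x.
  have -> : `|expR x - 1| = expR x - 1 by rewrite ger0_norm //; lra.
  by rewrite ger0_norm //; nra.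
have e1 : expR x <= 1 by rewrite -[leRHS](@expR0 R) ler_expR ltW.
have -> : `|expR x - 1| = 1 - expR x by rewrite ler0_norm ?opprB //; lra.
rewrite ltr0_norm //; nra.
Qed.

Lemma norm_expR_taylor1 (R : realType) (x : R) :
  `|expR x - 1 - x| <= x ^+ 2 * expR `|x|.
Proof.
have h := @expR_ge1Dx R x; have h' := @expR_ge1Dx R (- x).
have e0 := expR_gt0 x; have ee : expR (- x) * expR x = 1.
  by rewrite -expRD addNr expR0.
have -> : `|expR x - 1 - x| = expR x - 1 - x by rewrite ger0_norm //; lra.
(* This is again [(1 - x) * expR x <= 1], rearranged. *)
have le1 : expR x - 1 - x <= x * (expR x - 1) by nra.
apply: (le_trans le1); apply: (le_trans (ler_norm _)).
rewrite normrM -[x ^+ 2]real_normK ?num_real // expr2 -mulrA.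
by rewrite ler_wpM2l // norm_expR_sub1.
Qed.

Lemma norm_sin_le (R : realType) (x : R) : `|sin x| <= `|x|.
Proof.
wlog x0 : x / 0 <= x => [th|].
  have [/th //|/ltW x0] := leP 0 x.
  by rewrite -normrN -sinN -[`|x|]normrN th // oppr_ge0.
have [|c _] := @MVT_segment R sin cos 0 x x0.
  by apply: continuous_subspaceT; exact: continuous_sin.
rewrite sin0 !subr0 => ->; rewrite normrM ler_piMl //.
by rewrite ler_norml cos_geN1 cos_le1.
Qed.

Lemma sub1_cosE (R : realType) (x : R) : 1 - cos x = 2 * sin (x / 2) ^+ 2.
Proof.
rewrite {1}(splitr x) cosD -!expr2.
have := cos2Dsin2 (x / 2); lra.
Qed.

Lemma norm_sub1_cos (R : realType) (x : R) : `|cos x - 1| <= x ^+ 2.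
Proof.
rewrite distrC sub1_cosE normrM normrX ger0_norm //.
have : `|sin (x / 2)| ^+ 2 <= `|x / 2| ^+ 2.
  by rewrite lerXn2r ?nnegrE // norm_sin_le.
rewrite -[X in _ <= X -> _]normrX [X in _ <= X -> _]ger0_norm ?sqr_ge0 //.
move: (`|sin _| ^+ 2) => s; nra.
Qed.

Lemma norm_sub1_cos_le (R : realType) (x : R) : `|cos x - 1| <= `|x|.
Proof.
rewrite distrC sub1_cosE normrM normrX ger0_norm //.
have h := @norm_sin_le R (x / 2); rewrite normrM [`|2^-1|]ger0_norm // in h.
have : `|sin (x / 2)| <= 1 by rewrite ler_norml sin_geN1 sin_le1.
move: (normr_ge0 (sin (x / 2))); move: (`|sin _|) (`|x|) h => s y; nra.
Qed.

(** By the mean value theorem for [sin z - z], whose derivative [cos z - 1] is at most [z] in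
    modulus on [[0, x]]; oddness reduces to [x >= 0]. *)
Lemma norm_sin_sub (R : realType) (x : R) : `|sin x - x| <= x ^+ 2.
Proof.
wlog x0 : x / 0 <= x => [th|].
  have [/th //|/ltW x0] := leP 0 x.
  by rewrite -normrN opprD -sinN -[x ^+ 2]sqrrN th // oppr_ge0.
have [|c cx] := @MVT_segment R (fun z => sin z - z) (fun z => cos z - 1) 0 x x0.
  apply: continuous_subspaceT => z.
  by apply: (@continuousB _ _ R); [exact: continuous_sin | exact: cvg_id].
rewrite sin0 !subr0 => ->; rewrite normrM expr2 [`|x|]ger0_norm //.
rewrite ler_wpM2r // (le_trans (norm_sub1_cos_le _)) //.
by move: cx; rewrite in_itv /= => /andP[c0 cx]; rewrite ger0_norm.
Qed.

(** * The complex exponential in polar form, with its first-order Taylor bound *)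

Definition cexp (R : realType) (z : R[i]) : R[i] :=
  (expR (complex.Re z))%:C * (cos (complex.Im z) +i* sin (complex.Im z)).

Lemma cexpD (R : realType) (z w : R[i]) : cexp (z + w) = cexp z * cexp w.
Proof.
case: z w => [a b] [c d]; rewrite /cexp /= expRD cosD sinD rmorphM /=.
rewrite mulrACA; congr (_ * _).
by apply/eqP; rewrite eq_complex /= eqxx /= addrC.
Qed.

Lemma cexp0 (R : realType) : cexp (0 : R[i]) = 1.
Proof. by rewrite /cexp /= expR0 cos0 sin0 mul1r. Qed.

Lemma normc_cexp (R : realType) (z : R[i]) : normc (cexp z) = expR (complex.Re z).
Proof.
rewrite /cexp Normc.normcM normc_real ger0_norm ?expR_ge0 //=.
by rewrite cos2Dsin2 sqrtr1 mulr1.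
Qed.

Lemma normc_cexp_le (R : realType) (z : R[i]) : normc (cexp z) <= expR (normc z).
Proof.
by rewrite normc_cexp ler_expR (le_trans (ler_norm _)) // ler_Re_normc.
Qed.

Lemma normc_cexp_taylor1 (R : realType) (z : R[i]) :
  normc (cexp z - 1 - z) <= 4 * normc z ^+ 2 * expR (normc z).
Proof.
have [hx hy] := (ler_Re_normc z, ler_Im_normc z).
have nz0 := normc_ge0 z.
move: (normc z) hx hy nz0 => n hx hy n0.
rewrite (le_trans (normc_le_ReIm _)) //.
case: z hx hy => x y /= hx hy.
have e0 := expR_gt0 x.
have exn : expR x <= expR n by rewrite ler_expR (le_trans (ler_norm _)).
have exn' : expR `|x| <= expR n by rewrite ler_expR.
have x2 : x ^+ 2 <= n ^+ 2 by rewrite -real_normK ?num_real // lerXn2r ?nnegrE.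
have y2 : y ^+ 2 <= n ^+ 2 by rewrite -real_normK ?num_real // lerXn2r ?nnegrE.
(* The real part of the remainder and its imaginary part are each split into two terms, and each of
   the four terms is at most [n ^+ 2 * expR n]; hence the constant 4. *)
have bnd (u v : R) : 0 <= u -> u <= n ^+ 2 -> 0 <= v -> v <= expR n ->
  u * v <= n ^+ 2 * expR n by move=> *; rewrite ler_pM.
have re : `|expR x * (cos y - 1) + (expR x - 1 - x)| <= 2 * (n ^+ 2 * expR n).
  rewrite (le_trans (ler_normD _ _)) // mulr_natl mulr2n lerD //.
    by rewrite mulrC normrM [`|expR x|]ger0_norm ?(ltW e0) // bnd ?(ltW e0) //
      (le_trans (norm_sub1_cos _)).
  by rewrite (le_trans (norm_expR_taylor1 _)) // bnd ?sqr_ge0 ?expR_ge0.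
have im : `|expR x * (sin y - y) + (expR x - 1) * y| <= 2 * (n ^+ 2 * expR n).
  rewrite (le_trans (ler_normD _ _)) // mulr_natl mulr2n lerD //.
    by rewrite mulrC normrM [`|expR x|]ger0_norm ?(ltW e0) // bnd ?(ltW e0) //
      (le_trans (norm_sin_sub _)).
  rewrite normrM (@le_trans _ _ (`|x| * expR `|x| * `|y|)) //.
    by rewrite ler_wpM2r // norm_expR_sub1.
  by rewrite mulrAC bnd ?mulr_ge0 ?expR_ge0 // expr2 ler_pM.
have -> : 4 * n ^+ 2 * expR n = 2 * (n ^+ 2 * expR n) + 2 * (n ^+ 2 * expR n).
  by ring.
apply: lerD; [move: re | move: im]; congr (`| _ | <= _); ring.
Qed.

Lemma normc_cexp_sub1 (R : realType) (z : R[i]) :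
  normc z <= 1 -> normc (cexp z - 1) <= (4 * expR 1 + 1) * normc z.
Proof.
move=> z1; have -> : cexp z - 1 = (cexp z - 1 - z) + z by rewrite subrK.
rewrite (le_trans (le_normcD _ _)) // mulrDl mul1r lerD2r.
rewrite (le_trans (normc_cexp_taylor1 _)) // -!mulrA ler_pM2l // mulrC.
rewrite ler_wpM2r ?normc_ge0 // -[leRHS]mul1r.
by rewrite ler_pM ?normc_ge0 ?expR_ge0 ?ler_expR.
Qed.

(** Since [(1 + a) * (1 - a) = 1 - a ^+ 2], the linear terms cancel: what is left is the Taylor
    remainder of [cexp (- a)] and [a ^+ 2]. *)
Lemma normc_cexp_factor (R : realType) (K : R) (a : R[i]) : normc a <= K ->
  normc ((1 + a) * cexp (- a) - 1) <= ((1 + K) * (4 * expR K) + 1) * normc a ^+ 2.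
Proof.
move=> aK; have a0 := normc_ge0 a.
have -> : (1 + a) * cexp (- a) - 1 = (1 + a) * (cexp (- a) - 1 - - a) - a ^+ 2.
  by ring.
rewrite (le_trans (ler_normcB _ _)) // [leRHS]mulrDl mul1r lerD //; last first.
  by rewrite expr2 Normc.normcM.
rewrite Normc.normcM -mulrA ler_pM ?normc_ge0 //.
  by rewrite (le_trans (le_normcD _ _)) // Normc.normc1 lerD2l.
rewrite (le_trans (normc_cexp_taylor1 _)) // normcN mulrAC.
by rewrite ler_wpM2r ?sqr_ge0 // ler_pM2l // ler_expR.
Qed.

(** * The scalar majorant recursion and its energy *)

Lemma lyapunov_step (R : realFieldType) (m B : R) : 0 <= m -> m < 1 -> 0 <= B ->
  exists eta M : R, [/\ 0 < eta, 0 <= M & forall e p q : R,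
    0 <= e -> e ^+ 2 <= B ->
    ((1 + e ^+ 2) * p + e * q) ^+ 2 + (e * p + (m + e) * q) ^+ 2 <=
    (1 + M * e ^+ 2) * (p ^+ 2 + q ^+ 2) - eta * q ^+ 2].
Proof.
(* The contraction gains [1 - m ^+ 2 = 3 * eta] on [q ^+ 2]: one third pays for the cross term in
   [p * q], one for [2 * m * e * q ^+ 2], and one remains as dissipation. *)
move=> m0 m1 B0; pose eta := (1 - m ^+ 2) / 3; pose i := eta^-1.
have eta0 : 0 < eta by rewrite divr_gt0 //; nra.
have i0 : 0 <= i by rewrite invr_ge0 ltW.
have ei : eta * i = 1 by rewrite divff // gt_eqF.
(* [M] adds up the coefficients that arise for [e ^+ 2 * p ^+ 2] and for [e ^+ 2 * q ^+ 2], so that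
   it serves both; [hp] and [hq] below are the surplus. *)
exists eta, (5 + B + (3 + 2 * B) ^+ 2 * i + i); split=> //.
  by rewrite !addr_ge0 // mulr_ge0 // sqr_ge0.
(* [G] is the coefficient of [2 * e * p * q] in the expanded left-hand side. *)
move=> e p q e0 eB; pose G := 1 + e ^+ 2 + (m + e).
have e2 := sqr_ge0 e; have p2 := sqr_ge0 p; have q2 := sqr_ge0 q.
have Gle : G ^+ 2 <= (3 + 2 * B) ^+ 2.
  by rewrite lerXn2r ?nnegrE /G; nra.
(* Young's inequality, from [eta * (q - i * (e * G * p)) ^+ 2 >= 0]. *)
have cross : 2 * e * G * p * q <= eta * q ^+ 2 + i * (e ^+ 2 * G ^+ 2 * p ^+ 2).
  have := mulr_ge0 (ltW eta0) (sqr_ge0 (q - i * (e * G * p))).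
  rewrite (_ : eta * (_ - _) ^+ 2 = eta * q ^+ 2 - 2 * (eta * i) * (e * G * p) * q +
    (eta * i) * i * (e * G * p) ^+ 2); last by ring.
  rewrite ei; lra.
have me : 2 * m * e <= eta + i * e ^+ 2.
  have := mulr_ge0 (ltW eta0) (sqr_ge0 (1 - i * (m * e))).
  rewrite (_ : eta * (_ - _) ^+ 2 = eta - 2 * (eta * i) * (m * e) +
    (eta * i) * i * (m * e) ^+ 2); last by ring.
  have : i * (m * e) ^+ 2 <= i * e ^+ 2.
    by rewrite ler_wpM2l // exprMn ler_piMl // expr_le1 // ltW.
  rewrite ei; lra.
have cross' : i * (e ^+ 2 * G ^+ 2 * p ^+ 2) <=
    i * (e ^+ 2 * (3 + 2 * B) ^+ 2 * p ^+ 2).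
  by rewrite ler_wpM2l // ler_wpM2r // ler_wpM2l.
have me' := ler_wpM2r q2 me.
have e4 : e ^+ 2 * e ^+ 2 * p ^+ 2 <= B * e ^+ 2 * p ^+ 2.
  by rewrite ler_wpM2r // ler_wpM2r.
have hm : 3 * eta = 1 - m ^+ 2 by rewrite /eta; field.
have hq : 0 <= (3 + B + (3 + 2 * B) ^+ 2 * i) * e ^+ 2 * q ^+ 2.
  rewrite mulr_ge0 // mulr_ge0 // addr_ge0 ?addr_ge0 //.
  by rewrite mulr_ge0 // sqr_ge0.
have hp : 0 <= (2 + i) * e ^+ 2 * p ^+ 2 by rewrite mulr_ge0 // mulr_ge0 // addr_ge0.
have -> : ((1 + e ^+ 2) * p + e * q) ^+ 2 + (e * p + (m + e) * q) ^+ 2 =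
  p ^+ 2 + 3 * (e ^+ 2 * p ^+ 2) + e ^+ 2 * e ^+ 2 * p ^+ 2 +
  2 * e * G * p * q + 2 * (e ^+ 2 * q ^+ 2) + 2 * m * e * q ^+ 2
  + (1 - (1 - m ^+ 2)) * q ^+ 2 by rewrite /G; ring.
by rewrite -hm; lra.
Qed.

Section Majorant.
Variables (R : realType) (m B : R) (e : nat -> R).
Hypotheses (m0 : 0 <= m) (m1 : m < 1) (e0 : forall n, 0 <= e n).
Hypothesis eB : forall N, \sum_(0 <= k < N) e k ^+ 2 <= B.
Variables P Q : nat -> R.
Hypotheses (P0 : 0 <= P 0) (Q0 : 0 <= Q 0).
Hypothesis PS : forall n, P n.+1 = (1 + e n ^+ 2) * P n + e n * Q n.
Hypothesis QS : forall n, Q n.+1 = e n * P n + (m + e n) * Q n.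

Lemma majorant_ge0 n : 0 <= P n /\ 0 <= Q n.
Proof.
elim: n => // n [Pn Qn]; rewrite PS QS.
by rewrite !addr_ge0 ?mulr_ge0 ?addr_ge0 ?sqr_ge0.
Qed.

Lemma majorant_nondecreasing : {homo P : n k / (n <= k)%N >-> n <= k}.
Proof.
apply: (homo_leq (@lexx _ R) (@le_trans _ R)) => n.
have [Pn Qn] := majorant_ge0 n.
by rewrite PS mulrDl mul1r -addrA lerDl addr_ge0 ?mulr_ge0 ?sqr_ge0.
Qed.

(** A discrete Gronwall argument: each step multiplies the energy by at most
    [1 + M * e n ^+ 2 <= expR (M * e n ^+ 2)]. Keeping the dissipated amount on the left yields the
    summability of [Q ^+ 2] as well. *)
Lemma majorant_energy_bounded : exists2 eta : R, 0 < eta & exists C : R,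
  forall n, P n ^+ 2 + Q n ^+ 2 + eta * \sum_(0 <= k < n) Q k ^+ 2 <= C.
Proof.
have B0 : 0 <= B by have := eB 0; rewrite big_geq.
have eB1 n : e n ^+ 2 <= B.
  apply: le_trans (eB n.+1); rewrite big_nat_recr //= lerDr.
  by rewrite sumr_ge0 // => k _; rewrite sqr_ge0.
have [eta [M [eta0 M0 step]]] := lyapunov_step m0 m1 B0.
exists eta => //; exists ((P 0 ^+ 2 + Q 0 ^+ 2) * expR (M * B)) => n.
have W0 : 0 <= P 0 ^+ 2 + Q 0 ^+ 2 by rewrite addr_ge0 ?sqr_ge0.
apply: (@le_trans _ _
  ((P 0 ^+ 2 + Q 0 ^+ 2) * expR (M * \sum_(0 <= k < n) e k ^+ 2))); last first.
  by rewrite ler_wpM2l // ler_expR ler_wpM2l.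
elim: n => [|n IH]; first by rewrite !big_geq // !mulr0 addr0 expR0 mulr1.
rewrite !big_nat_recr //= PS QS [in leRHS]mulrDr expRD [leRHS]mulrA.
have := step _ (P n) (Q n) (e0 n) (eB1 n).
have E := expR_ge1Dx (M * e n ^+ 2).
have s0 : 0 <= eta * \sum_(0 <= k < n) Q k ^+ 2.
  by rewrite mulr_ge0 ?(ltW eta0) // sumr_ge0 // => k _; rewrite sqr_ge0.
set W := P n ^+ 2 + Q n ^+ 2 in IH *; move=> stepn.
have Wn : 0 <= W by rewrite addr_ge0 ?sqr_ge0.
have Me : 0 <= M * e n ^+ 2 by rewrite mulr_ge0 ?sqr_ge0.
(* The accumulated dissipation is multiplied by the growth factor too, which only enlarges the bound
   and lets the induction hypothesis apply as a whole. *)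
apply: le_trans (_ : (1 + M * e n ^+ 2) *
  (W + eta * \sum_(0 <= k < n) Q k ^+ 2) <= _).
  rewrite (mulrDr eta) [leRHS]mulrDr.
  have := mulr_ge0 Me s0; move: stepn; lra.
by rewrite mulrC ler_pM ?addr_ge0 ?sqr_ge0.
Qed.

Lemma majorant_bounded : exists C : R, forall n, P n <= C /\ Q n <= C.
Proof.
have [eta eta0 [C hC]] := majorant_energy_bounded.
(* From [p <= (1 + p ^+ 2) / 2]. *)
exists (1 + C) => n.
have : 0 <= eta * \sum_(0 <= k < n) Q k ^+ 2.
  by rewrite mulr_ge0 ?(ltW eta0) // sumr_ge0 // => k _; rewrite sqr_ge0.
have := sqr_ge0 (P n); have := sqr_ge0 (Q n).
have := sqr_ge0 (P n - 1); have := sqr_ge0 (Q n - 1).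
move: (eta * _) (hC n) => s hs *; split; lra.
Qed.

Lemma majorant_cauchy (eps : R) : 0 < eps ->
  exists N, forall n, (N <= n)%N -> P n - P N <= eps.
Proof.
move=> eps0; have [C hC] := majorant_bounded.
have cP : cvgn P.
  apply: nondecreasing_is_cvgn; first exact: majorant_nondecreasing.
  by exists C => _ [n _ <-]; case: (hC n).
have /cvgrPdist_le/(_ (eps / 2)) := cP; rewrite divr_gt0 // => /(_ isT).
case=> N _ hN; exists N => n Nn.
have := hN n Nn; have := hN N (leqnn N); rewrite /= !ler_norml; lra.
Qed.

(** The dissipation bounds the partial sums of [Q ^+ 2], so this series converges and its terms tend
    to 0. *)
Lemma majorant_cvg0 (eps : R) : 0 < eps ->
  exists N, forall n, (N <= n)%N -> Q n <= eps.
Proof.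
move=> eps0; have [eta eta0 [C hC]] := majorant_energy_bounded.
have cQ : cvgn (series (fun k => Q k ^+ 2)).
  apply: nondecreasing_is_cvgn.
    by apply: nondecreasing_series => n _ _; rewrite sqr_ge0.
  exists (C / eta) => _ [n _ <-]; rewrite ler_pdivlMr // mulrC.
  apply: le_trans (hC n); rewrite lerDr addr_ge0 ?sqr_ge0 //.
have /cvgrPdist_le/(_ (eps ^+ 2)) := cvg_series_cvg_0 cQ.
rewrite exprn_gt0 // => /(_ isT) [N _ hN]; exists N => n Nn.
have := hN n Nn; rewrite /= sub0r normrN ger0_norm ?sqr_ge0 //.
by rewrite ler_sqr // nnegrE ?(ltW eps0) //; case: (majorant_ge0 n).
Qed.
End Majorant.

(** * Uniformly Cauchy and uniformly bounded families of complex sequences *)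

Definition ucauchy (R : rcfType) (U : Type) (D : set U) (f : nat -> U -> R[i]) :=
  forall eps : R, 0 < eps -> exists N, forall n k t, (N <= n)%N -> (N <= k)%N ->
    D t -> normc (f n t - f k t) <= eps.

Definition ubounded (R : rcfType) (U : Type) (D : set U) (f : nat -> U -> R[i]) :=
  exists2 C : R, 0 <= C & forall n t, D t -> normc (f n t) <= C.

Section UniformlyCauchy.
Variables (R : rcfType) (U : Type) (D : set U).
Implicit Types f g : nat -> U -> R[i].

Lemma ucauchy_base f :
  (forall eps : R, 0 < eps -> exists N, forall n t, (N <= n)%N -> D t ->
    normc (f n t - f N t) <= eps) ->
  ucauchy D f.
Proof.
move=> hf eps eps0; have [N hN] := hf _ (divr_gt0 eps0 (@ltr0n R 2)).
exists N => n k t Nn Nk Dt.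
rewrite -(subrKA (f N t)) (le_trans (le_normcD _ _)) // [normc (f N t - _)]normcB.
by rewrite [leRHS]splitr lerD ?hN.
Qed.

(** Late terms stay within 1 of [f N]; the finitely many others are covered by the sum of their
    individual bounds. *)
Lemma ucauchy_ubounded f : ucauchy D f ->
  (forall n, exists C : R, forall t, D t -> normc (f n t) <= C) -> ubounded D f.
Proof.
move=> cf bf; have [N hN] := cf 1 ltr01.
have [b hb] := choice bf.
(* Absolute values are taken because a bound [b k] may be negative when [D] is empty. *)
exists (1 + \sum_(0 <= k < N.+1) `|b k|).
  by rewrite addr_ge0 // sumr_ge0.
have bsum n : (n <= N)%N -> `|b n| <= \sum_(0 <= k < N.+1) `|b k|.
  move=> nN; rewrite (bigD1_seq n) ?iota_uniq ?mem_index_iota //= lerDl.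
  by rewrite sumr_ge0.
move=> n t Dt; have [nN|/ltnW Nn] := leqP n N.
  rewrite (le_trans (hb n t Dt)) // (le_trans (ler_norm _)) //.
  by rewrite (le_trans (bsum n nN)) // lerDr.
rewrite -[f n t](subrK (f N t)) (le_trans (le_normcD _ _)) // lerD ?hN //.
by rewrite (le_trans (hb N t Dt)) // (le_trans (ler_norm _)) // bsum.
Qed.

Lemma ucauchyD f g : ucauchy D f -> ucauchy D g ->
  ucauchy D (fun n t => f n t + g n t).
Proof.
move=> cf cg eps eps0.
have [N hN] := cf _ (divr_gt0 eps0 (@ltr0n R 2)).
have [M hM] := cg _ (divr_gt0 eps0 (@ltr0n R 2)).
exists (maxn N M) => n k t; rewrite !geq_max => /andP[Nn Mn] /andP[Nk Mk] Dt.
rewrite opprD addrACA (le_trans (le_normcD _ _)) //.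
by rewrite [leRHS]splitr lerD ?hN ?hM.
Qed.

Lemma uboundedM f g : ubounded D f -> ubounded D g ->
  ubounded D (fun n t => f n t * g n t).
Proof.
move=> [C C0 hC] [M M0 hM]; exists (C * M); rewrite ?mulr_ge0 // => n t Dt.
by rewrite Normc.normcM ler_pM ?normc_ge0 ?hC ?hM.
Qed.

Lemma ucauchyM f g : ubounded D f -> ubounded D g -> ucauchy D f -> ucauchy D g ->
  ucauchy D (fun n t => f n t * g n t).
Proof.
move=> [C C0 hC] [M M0 hM] cf cg eps eps0.
have K0 : 0 < C + M + 1 by rewrite ltr_wpDl // addr_ge0.
have d0 : 0 < eps / (C + M + 1) by rewrite divr_gt0.
have [N1 h1] := cf _ d0; have [N2 h2] := cg _ d0.
exists (maxn N1 N2) => n k t; rewrite !geq_max => /andP[n1 n2] /andP[k1 k2] Dt.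
have -> : f n t * g n t - f k t * g k t =
  f n t * (g n t - g k t) + (f n t - f k t) * g k t by ring.
rewrite (le_trans (le_normcD _ _)) // !Normc.normcM.
apply: (@le_trans _ _ (C * (eps / (C + M + 1)) + eps / (C + M + 1) * M)).
  by rewrite lerD // ler_pM ?normc_ge0 ?hC ?hM ?h1 ?h2.
rewrite [C * _]mulrC -mulrDr mulrAC ler_pdivrMr // ler_pM2l //.
by rewrite lerDl.
Qed.

End UniformlyCauchy.

Lemma ubounded_cexp (R : realType) (U : Type) (D : set U) (S : nat -> U -> R[i]) :
  ubounded D S -> ubounded D (fun n t => cexp (S n t)).
Proof.
move=> [C C0 hC]; exists (expR C); rewrite ?expR_ge0 // => n t Dt.
by rewrite (le_trans (normc_cexp_le _)) // ler_expR hC.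
Qed.

(** On bounded sets [cexp] is Lipschitz at small distances: factor [cexp (S k t)] out of the
    difference and use the linear bound for [cexp w - 1]. *)
Lemma ucauchy_cexp (R : realType) (U : Type) (D : set U) (S : nat -> U -> R[i]) :
  ubounded D S -> ucauchy D S -> ucauchy D (fun n t => cexp (S n t)).
Proof.
move=> bS cS eps eps0; have [C C0 hC] := ubounded_cexp bS.
pose K : R := (C + 1) * (4 * expR 1 + 1).
have e1 := expR_gt0 (1 : R).
have K0 : 0 < K by rewrite mulr_gt0 ?ltr_wpDl // mulr_ge0 // ltW.
(* The minimum with 1 is there because the linear bound for [cexp w - 1] requires [normc w <= 1]. *)
have d0 : 0 < Num.min 1 (eps / K) by rewrite lt_min ltr01 divr_gt0.
have [N hN] := cS _ d0; exists N => n k t Nn Nk Dt.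
have := hN n k t Nn Nk Dt; rewrite le_min => /andP[s1 sK].
have -> : cexp (S n t) - cexp (S k t) = cexp (S k t) * (cexp (S n t - S k t) - 1).
  by rewrite mulrBr mulr1 -cexpD [S k t + _]addrC subrK.
rewrite Normc.normcM.
apply: (@le_trans _ _ (C * ((4 * expR 1 + 1) * (eps / K)))).
  rewrite ler_pM ?normc_ge0 ?hC // (le_trans (normc_cexp_sub1 s1)) //.
  by rewrite ler_wpM2l // addr_ge0 // mulr_ge0 // ltW.
rewrite !mulrA ler_pdivrMr // mulrC ler_pM2l // /K.
by rewrite ler_wpM2r ?lerDl // addr_ge0 // mulr_ge0 // ltW.
Qed.

(** * Domination of a perturbed diagonal system by the scalar majorant *)

Fixpoint majorant (R : pzRingType) (m : R) (e : nat -> R) (p q : R) (n : nat) :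
    R * R :=
  if n is n'.+1 then
    let: (x, y) := majorant m e p q n' in
    ((1 + e n' ^+ 2) * x + e n' * y, e n' * x + (m + e n') * y)
  else (p, q).

(** The triangle inequality applied to both recursions. The third bound is what makes [u] Cauchy:
    its increments telescope against those of a bounded monotone sequence. *)
Lemma majorant_dominates (R : rcfType) (m : R) (e : nat -> R) (p q : R)
    (al be ga de u y : nat -> R[i]) :
  (forall n, normc (al n) <= e n ^+ 2) -> (forall n, normc (be n) <= e n) ->
  (forall n, normc (ga n) <= e n) -> (forall n, normc (de n) <= m + e n) ->
  normc (u 0) <= p -> normc (y 0) <= q ->
  (forall n, u n.+1 = u n + (al n * u n + be n * y n)) ->
  (forall n, y n.+1 = ga n * u n + de n * y n) ->
  forall n, [/\ normc (u n) <= (majorant m e p q n).1,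
    normc (y n) <= (majorant m e p q n).2 &
    normc (u n.+1 - u n) <= (majorant m e p q n.+1).1 - (majorant m e p q n).1].
Proof.
move=> ale bee gae dee up yq uS yS.
have step (al' be' : R[i]) (a b P Q : R) n : normc al' <= a -> normc be' <= b ->
    normc (u n) <= P -> normc (y n) <= Q ->
    normc (al' * u n + be' * y n) <= a * P + b * Q.
  move=> ha hb hP hQ; rewrite (le_trans (le_normcD _ _)) // !Normc.normcM.
  by rewrite lerD // ler_pM // normc_ge0.
have dom n : normc (u n) <= (majorant m e p q n).1 /\
    normc (y n) <= (majorant m e p q n).2.
  elim: n => [//|n /=]; case: (majorant m e p q n) => P Q /= [uP yQ]; split.
    rewrite uS mulrDl mul1r -addrA (le_trans (le_normcD _ _)) // lerD //.
    exact: step.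
  by rewrite yS; exact: step.
move=> n; have [uP yQ] := dom n; split=> //.
rewrite uS addrAC subrr add0r /=.
case: (majorant m e p q n) uP yQ => P Q /= uP yQ.
have -> : (1 + e n ^+ 2) * P + e n * Q - P = e n ^+ 2 * P + e n * Q by ring.
exact: step.
Qed.

(* Multiplying [x] by [cexp (- S)] absorbs the coefficients [a], whose series
   converges only conditionally, up to absolutely summable errors. *)
Section PerturbedDiagonalSystem.
Variables (R : realType) (U : Type) (D : set U) (mu : R[i]) (B : R) (e : nat -> R).
Variables a b c d x y : nat -> U -> R[i].
Hypotheses (mu1 : normc mu < 1) (e0 : forall n, 0 <= e n).
Hypothesis eB : forall N, \sum_(0 <= k < N) e k ^+ 2 <= B.
Hypotheses (ae : forall n t, D t -> normc (a n t) <= e n)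
           (be : forall n t, D t -> normc (b n t) <= e n)
           (ce : forall n t, D t -> normc (c n t) <= e n)
           (de : forall n t, D t -> normc (d n t) <= e n).
Let S N t := \sum_(0 <= k < N) a k t.
Hypothesis cS : ucauchy D S.
Variable C0 : R.
Hypotheses (x0 : forall t, D t -> normc (x 0 t) <= C0)
           (y0 : forall t, D t -> normc (y 0 t) <= C0).
Hypothesis xS : forall n t, D t ->
  x n.+1 t = (1 + a n t) * x n t + b n t * y n t.
Hypothesis yS : forall n t, D t ->
  y n.+1 t = c n t * x n t + (mu + d n t) * y n t.

Let bS : ubounded D S.
Proof.
apply: ucauchy_ubounded => // n; exists (\sum_(0 <= k < n) e k) => t Dt.
by rewrite (le_trans (ler_normc_sum _ _)) // ler_sum // => k _; exact: ae.
Qed.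

Let u n t := cexp (- S n t) * x n t.

(** Passing from [x] to [u] multiplies the off-diagonal coefficients by [cexp (- S)] or [cexp S],
    bounded because [S] is. One constant [K] absorbs these factors, so the majorant is the same for
    all [t]. *)
Lemma perturbed_system_dominated : exists (K : R) (p q : R),
  [/\ 1 <= K, 0 <= p, 0 <= q & forall n t, D t ->
    [/\ normc (u n t) <= (majorant (normc mu) (fun k => K * e k) p q n).1,
        normc (y n t) <= (majorant (normc mu) (fun k => K * e k) p q n).2 &
        normc (u n.+1 t - u n t) <=
          (majorant (normc mu) (fun k => K * e k) p q n.+1).1 -
          (majorant (normc mu) (fun k => K * e k) p q n).1]].
Proof.
have B0 : 0 <= B by have := eB 0; rewrite big_geq.
have e1B n : e n <= 1 + B.
  have : e n ^+ 2 <= B.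
    apply: le_trans (eB n.+1); rewrite big_nat_recr //= lerDr.
    by rewrite sumr_ge0 // => k _; rewrite sqr_ge0.
  have := e0 n; nra.
have [s s0 hs] := bS; pose E := expR s.
have E0 : 0 < E := expR_gt0 _.
(* The constant of [normc_cexp_factor] for the bound [1 + B] on [a]. *)
pose Ka := (1 + (1 + B)) * (4 * expR (1 + B)) + 1.
have Ka0 : 0 <= Ka by rewrite !addr_ge0 // !mulr_ge0 ?addr_ge0 ?expR_ge0.
pose K := Ka + E + 1.
have K1 : 1 <= K by rewrite lerDr addr_ge0 // ltW.
have hw n t : D t -> normc (cexp (- S n t)) <= E.
  by move=> Dt; rewrite (le_trans (normc_cexp_le _)) // normcN ler_expR hs.
have hw' n t : D t -> normc (cexp (S n t)) <= E.
  by move=> Dt; rewrite (le_trans (normc_cexp_le _)) // ler_expR hs.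
have xu n t : x n t = cexp (S n t) * u n t.
  by rewrite /u mulrA -cexpD subrr cexp0 mul1r.
pose al n t := (1 + a n t) * cexp (- a n t) - 1.
(* The new [u] carries [S] at index [n.+1], hence so does the coefficient of [y], whereas the
   recursion for [y] involves [S n]. *)
have uS n t : D t ->
    u n.+1 t = u n t + (al n t * u n t + cexp (- S n.+1 t) * b n t * y n t).
  move=> Dt; rewrite {1}/u xS // {1 2}/S big_nat_recr //= -/(S n t) opprD !cexpD.
  rewrite /al /u; ring.
have yS' n t : D t ->
    y n.+1 t = c n t * cexp (S n t) * u n t + (mu + d n t) * y n t.
  by move=> Dt; rewrite yS // xu mulrA.
have ale n t : D t -> normc (al n t) <= (K * e n) ^+ 2.
  move=> Dt; have an := ae n Dt.
  rewrite (le_trans (normc_cexp_factor (le_trans an (e1B n)))) // -/Ka exprMn.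
  rewrite ler_pM ?sqr_ge0 // ?lerXn2r ?nnegrE ?normc_ge0 //.
  (* [Ka <= K <= K ^+ 2], the latter since [K >= 1]. *)
  by rewrite (@le_trans _ _ K) // ?ler_eXnr // /K -addrA lerDl addr_ge0 // ltW.
have EK : E <= K by rewrite /K addrAC lerDr addr_ge0.
have bee n t : D t -> normc (cexp (- S n.+1 t) * b n t) <= K * e n.
  move=> Dt; rewrite Normc.normcM ler_pM ?normc_ge0 ?be //.
  exact: le_trans (hw _ _ Dt) EK.
have cee n t : D t -> normc (c n t * cexp (S n t)) <= K * e n.
  move=> Dt; rewrite mulrC Normc.normcM ler_pM ?normc_ge0 ?ce //.
  exact: le_trans (hw' _ _ Dt) EK.
have dee n t : D t -> normc (mu + d n t) <= normc mu + K * e n.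
  move=> Dt; rewrite (le_trans (le_normcD _ _)) // lerD2l (le_trans (de n Dt)) //.
  by rewrite ler_peMl.
exists K, `|C0|, `|C0|; split=> // n t Dt.
apply: (@majorant_dominates R (normc mu) (fun k => K * e k) `|C0| `|C0|
  (al^~ t) (fun k => cexp (- S k.+1 t) * b k t) (fun k => c k t * cexp (S k t))
  (fun k => mu + d k t) (u^~ t) (y^~ t)) => [k|k|k|k|||k|k].
- exact: ale.
- exact: bee.
- exact: cee.
- exact: dee.
- rewrite /u /S big_geq // oppr0 cexp0 mul1r.
  by rewrite (le_trans (x0 Dt)) // ler_norm.
- by rewrite (le_trans (y0 Dt)) // ler_norm.
- exact: uS.
- exact: yS'.
Qed.

(** [u] is Cauchy by comparison of increments with [P], [y] because it is dominated by [Q], which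
    tends to 0, and [x] as the product of [cexp S] and [u]. *)
Lemma perturbed_system_ucauchy : [/\ ucauchy D x, ucauchy D y,
  ubounded D x & ubounded D y].
Proof.
have [K [p [q [K1 p0 q0 dom]]]] := perturbed_system_dominated.
set M := majorant _ _ _ _ in dom.
pose P n := (M n).1; pose Q n := (M n).2.
have K0 : 0 <= K by rewrite (le_trans _ K1).
have Ke0 n : 0 <= K * e n by rewrite mulr_ge0.
have KeB N : \sum_(0 <= k < N) (K * e k) ^+ 2 <= K ^+ 2 * B.
  under eq_bigr do rewrite exprMn.
  by rewrite -mulr_sumr ler_wpM2l ?sqr_ge0.
have PS n : P n.+1 = (1 + (K * e n) ^+ 2) * P n + (K * e n) * Q n.
  by rewrite /P /Q /M /=; case: majorant.
have QS n : Q n.+1 = (K * e n) * P n + (normc mu + K * e n) * Q n.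
  by rewrite /P /Q /M /=; case: majorant.
have mu0 := normc_ge0 mu.
have [C hC] := majorant_bounded mu0 mu1 Ke0 KeB PS QS.
have C1 : 0 <= C by rewrite (le_trans p0) //; case: (hC 0).
have by_ : ubounded D y.
  exists C => // n t Dt; have [_ yn _] := dom n t Dt.
  by rewrite (le_trans yn) //; case: (hC n).
have bu : ubounded D u.
  exists C => // n t Dt; have [un _ _] := dom n t Dt.
  by rewrite (le_trans un) //; case: (hC n).
have cu : ucauchy D u.
  apply: ucauchy_base => eps eps0.
  have [N hN] := majorant_cauchy mu0 mu1 Ke0 KeB p0 q0 PS QS eps0.
  (* Increments from [N] to [n] are summed by induction, against [P n - P N]. *)
  exists N => n t Nn Dt; apply: le_trans (hN n Nn).
  elim: n Nn => [|n IH]; first by rewrite leqn0 => /eqP ->; rewrite !subrr Normc.normc0.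
  rewrite leq_eqVlt => /orP[/eqP <-|Nn]; first by rewrite !subrr Normc.normc0.
  rewrite -(subrKA (u n t)) -(subrKA (P n)).
  rewrite (le_trans (le_normcD _ _)) // lerD ?IH //.
  by case: (dom n t Dt).
have cy : ucauchy D y.
  move=> eps eps0.
  have [N hN] := majorant_cvg0 mu0 mu1 Ke0 KeB p0 q0 PS QS
    (divr_gt0 eps0 (@ltr0n R 2)).
  exists N => n k t Nn Nk Dt.
  have yle j : (N <= j)%N -> normc (y j t) <= eps / 2.
    by move=> Nj; have [_ yj _] := dom j t Dt; exact: le_trans yj (hN j Nj).
  by rewrite (le_trans (ler_normcB _ _)) // [leRHS]splitr lerD ?yle.
have xu : x = (fun n t => cexp (S n t) * u n t).
  apply/funext => n; apply/funext => t.
  by rewrite /u mulrA -cexpD subrr cexp0 mul1r.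
split=> //; rewrite xu; first apply: ucauchyM => //; last apply: uboundedM => //.
- exact: ubounded_cexp.
- exact: ucauchy_cexp.
- exact: ubounded_cexp.
Qed.

End PerturbedDiagonalSystem.

(** * Equivalence of norms: any matrix norm controls the entries *)

Lemma ler_norm_coord (R : realDomainType) m n (M : 'M[R]_(m, n)) i j :
  `|M i j| <= `|M|.
Proof.
rewrite [leRHS]/Num.norm /= mx_normrE.
exact: (le_bigmax 0 (fun ij : 'I_m * 'I_n => `|M ij.1 ij.2|) (i, j)).
Qed.

(** [f] is Lipschitz for the sup norm, hence attains a minimum on the compact unit sphere, positive
    by definiteness; [C] is its inverse. *)
Lemma real_norm_equiv (R : realType) n (f : 'rV[R]_n -> R) :
  (forall v, 0 <= f v) -> (forall v, f v = 0 -> v = 0) ->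
  (forall v w, f (v + w) <= f v + f w) ->
  (forall a v, f (a *: v) = `|a| * f v) ->
  exists2 C : R, 0 <= C & forall v, `|v| <= C * f v.
Proof.
move=> f_ge0 f_eq0 fD fZ.
have f0 : f 0 = 0 by rewrite -(scale0r 0) fZ normr0 mul0r.
have fN v : f (- v) = f v by rewrite -scaleN1r fZ normrN1 mul1r.
pose c := \sum_(j < n) f 'e_j.
have fle v : f v <= `|v| * c.
  rewrite {1}[v]row_sum_delta.
  apply: (@le_trans _ _ (\sum_(j < n) f (v 0 j *: 'e_j))).
    elim/big_ind2: _ => [|x a y b xa yb|//]; first by rewrite f0.
    by rewrite (le_trans (fD _ _)) // lerD.
  rewrite mulr_sumr ler_sum // => j _.
  by rewrite fZ ler_wpM2r ?ler_norm_coord.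
have c0 : 0 <= c by rewrite sumr_ge0.
have fB v w : `|f v - f w| <= `|v - w| * c.
  have h a b : f a - f b <= `|a - b| * c.
    by rewrite lerBlDr -[in leLHS](subrK b a) (le_trans (fD _ _)) // lerD2r.
  by rewrite ler_norml h andbT lerNl opprB distrC h.
have cf : continuous f.
  move=> v; apply/(@cvgrPdist_le _ R _ _ (nbhs_filter v)) => eps eps0; near=> w.
  rewrite (le_trans (fB _ _)) //.
  apply: (@le_trans _ _ (eps / (c + 1) * c)).
    rewrite ler_wpM2r //; near: w.
    have : (fun w : 'rV[R]_n => w) @ nbhs v --> v by exact: cvg_id.
    by move=> /(@cvgrPdist_le _ _ _ _ (nbhs_filter v)); apply;
      rewrite divr_gt0 // ltr_wpDl.
  by rewrite mulrAC ler_pdivrMr ?ltr_wpDl // ler_wpM2l ?lerDl // ltW.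
(* In dimension 0 the sphere is empty and there is no minimum to take. *)
have [[v v0]|no] := pselect (exists v : 'rV[R]_n, v != 0); last first.
  exists 0 => // v; have [->|v0] := eqVneq v 0; first by rewrite normr0 mul0r.
  by exfalso; apply: no; exists v.
pose A : set 'rV[R]_n := [set w | `|w| = 1].
have nv (w : 'rV[R]_n) : w != 0 -> A (`|w|^-1 *: w).
  by move=> w0; rewrite /A /= normrZ normfV normr_id mulVf // normr_eq0.
have cA : compact A.
  apply: bounded_closed_compact.
    exists 1; split=> // x x1 w /= ->; exact: ltW.
  apply: (@preimage_closed _ _ (fun w : 'rV[R]_n => `|w|) [set 1 : R]).
    by move=> w _; exact: norm_continuous.
  exact: closed_eq.
have [|||w] := @EVT_min_rV R n f A.
- by exists (`|v|^-1 *: v); exact: nv.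
- by [].
- exact: continuous_subspaceT.
rewrite inE /A /= => w1 hw.
have fw : 0 < f w.
  rewrite lt_neqAle f_ge0 andbT eq_sym; apply/negP => /eqP/f_eq0 w0.
  by move: w1; rewrite w0 normr0 => /esym/eqP; rewrite oner_eq0.
exists (f w)^-1 => [|u]; first by rewrite invr_ge0 ltW.
have [->|u0] := eqVneq u 0; first by rewrite normr0 f0 mulr0.
have := hw (`|u|^-1 *: u); rewrite inE => /(_ (nv u u0)).
rewrite fZ normfV normr_id mulrC ler_pdivlMr ?normr_gt0 // => hu.
by rewrite mulrC ler_pdivlMr // mulrC.
Unshelve. all: by end_near. Qed.

Definition complex_mx (R : rcfType) m n (v : 'rV[R]_(m * n + m * n)) :
    'M[R[i]]_(m, n) :=
  \matrix_(i, j) (v 0 (lshift _ (mxvec_index i j)) +i* v 0 (rshift _ (mxvec_index i j))).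

(** Through the real coordinates of [complex_mx], a complex norm is a norm on a real space. Real and
    imaginary parts cost one [C] each. *)
Lemma matrix_norm_coord (R : realType) m n (nu : 'M[R[i]]_(m, n) -> R) :
  matrix_norm nu ->
  exists2 C : R, 0 <= C & forall (M : 'M[R[i]]_(m, n)) j k, normc (M j k) <= C * nu M.
Proof.
move=> [nu_ge0 nu_eq0 nuD nuZ].
have [|v|v w|a v|C C0 hC] := @real_norm_equiv R _ (fun v => nu (complex_mx v)).
- by [].
- move=> /nu_eq0 /matrixP vM; apply/rowP => k; rewrite mxE.
  case: (split_ordP k) => j ->; case/mxvec_indexP: j => i j;
    by have := vM i j; rewrite !mxE => /eqP; rewrite eq_complex => /andP[/eqP ? /eqP ?].
- apply: le_trans (nuD _ _); rewrite le_eqVlt; apply/orP; left; apply/eqP.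
  by congr nu; apply/matrixP => i j; rewrite !mxE.
- have -> : complex_mx (a *: v) = a%:C *: complex_mx v.
    by apply/matrixP => i j; rewrite !mxE; simpc.
  by apply: complexI; rewrite nuZ rmorphM /= normr_normc normc_real.
exists (C + C); rewrite ?addr_ge0 // => M i j.
pose v := row_mx (mxvec (map_mx (@complex.Re R) M)) (mxvec (map_mx (@complex.Im R) M)).
have vM : complex_mx v = M.
  apply/matrixP => k l; rewrite !mxE (unsplitK (inl _)) (unsplitK (inr _)).
  by rewrite !mxvecE !mxE; case: (M k l).
have := hC v; rewrite vM => h.
rewrite (le_trans (normc_le_ReIm _)) // mulrDl lerD // (le_trans _ h) //.
  have := ler_norm_coord v 0 (lshift _ (mxvec_index i j)).
  by rewrite !mxE (unsplitK (inl _)) mxvecE mxE.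
have := ler_norm_coord v 0 (rshift _ (mxvec_index i j)).
by rewrite !mxE (unsplitK (inr _)) mxvecE mxE.
Qed.

(** * Limits of uniformly Cauchy families and convergence of complex matrices *)

Lemma cauchy_seq_lim (R : realType) (z : nat -> R) :
  (forall eps, 0 < eps -> exists N, forall n k, (N <= n)%N -> (N <= k)%N ->
    `|z n - z k| <= eps) ->
  forall eps N, (forall n k, (N <= n)%N -> (N <= k)%N -> `|z n - z k| <= eps) ->
  forall n, (N <= n)%N -> `|lim (z @ \oo) - z n| <= eps.
Proof.
move=> cz eps N hN n Nn.
have cvz : cvgn z.
  apply/cauchy_cvgP/cauchy_exP => d d0.
  have [M hM] := cz _ (divr_gt0 d0 (@ltr0n R 2)).
  exists (z M); exists M => // k Mk; rewrite /ball /= (le_lt_trans (hM M k _ Mk)) //.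
  by rewrite ltr_pdivrMr // ltr_pMr // ltr1n.
(* The limit is compared with [z n] through the index [maxn M N]: the Cauchy bound costs [eps], the
   convergence an arbitrary [d]. *)
apply/ler_addgt0Pr => d d0.
have /cvgrPdist_le/(_ d d0) [M _ hM] := cvz.
rewrite -(subrKA (z (maxn M N))) addrC (le_trans (ler_normD _ _)) // lerD //.
  by rewrite hN // leq_maxr.
by apply: hM; rewrite /= leq_maxl.
Qed.

(** Built from two real limits, so that completeness of [R] suffices; where one of them does not
    exist, [lim] returns a default value. *)
Definition clim (R : realType) (z : nat -> R[i]) : R[i] :=
  lim ((fun n => complex.Re (z n)) @ \oo) +i* lim ((fun n => complex.Im (z n)) @ \oo).

Lemma ReB (R : rcfType) (z w : R[i]) :
  complex.Re (z - w) = complex.Re z - complex.Re w.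
Proof. by case: z w => ? ? []. Qed.

Lemma ImB (R : rcfType) (z w : R[i]) :
  complex.Im (z - w) = complex.Im z - complex.Im w.
Proof. by case: z w => ? ? []. Qed.

Lemma ucauchy_clim (R : realType) (U : Type) (D : set U) (f : nat -> U -> R[i]) :
  ucauchy D f -> forall eps : R, 0 < eps -> exists N, forall n t, (N <= n)%N ->
    D t -> normc (clim (f^~ t) - f n t) <= eps.
Proof.
move=> cf eps eps0; have [N hN] := cf _ (divr_gt0 eps0 (@ltr0n R 2)).
exists N => n t Nn Dt; rewrite (le_trans (normc_le_ReIm _)) // ReB ImB /=.
rewrite [leRHS]splitr lerD //.
  apply: (@cauchy_seq_lim R (fun n => complex.Re (f n t)) _ _ N) => //.
    move=> d d0; have [M hM] := cf d d0; exists M => k l Mk Ml.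
    by rewrite -ReB (le_trans (ler_Re_normc _)) // hM.
  by move=> k l Nk Nl; rewrite -ReB (le_trans (ler_Re_normc _)) // hN.
apply: (@cauchy_seq_lim R (fun n => complex.Im (f n t)) _ _ N) => //.
  move=> d d0; have [M hM] := cf d d0; exists M => k l Mk Ml.
  by rewrite -ImB (le_trans (ler_Im_normc _)) // hM.
by move=> k l Nk Nl; rewrite -ImB (le_trans (ler_Im_normc _)) // hN.
Qed.

(** In the partial order of [R[i]] positive elements are real, so the complex radii of balls can be
    replaced by real ones. *)
Lemma complex_gt0P (R : rcfType) (e : R[i]) : 0 < e -> exists2 d : R, 0 < d & e = d%:C.
Proof.
by case: e => a b; rewrite ltcE /= => /andP[/eqP -> a0]; exists a.
Qed.

Lemma mx_ball_normc (R : realType) m n (M N : 'M[R[i]]_(m, n)) (d : R) : 0 < d ->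
  (forall i j, normc (M i j - N i j) < d) <-> ball M d%:C N.
Proof.
move=> d0; split=> [h|[_ h] i j].
  by split=> [|i j]; [rewrite ltcR | rewrite /ball /= normr_normc ltcR].
by have := h i j; rewrite /ball /= normr_normc ltcR.
Qed.

Lemma cvg_mx_normcP (R : realType) m n (T : Type) (F : set_system T)
    (FF : Filter F) (f : T -> 'M[R[i]]_(m, n)) (L : 'M[R[i]]_(m, n)) :
  f @ F --> L <-> forall eps : R, 0 < eps ->
    \forall t \near F, forall i j, normc (L i j - f t i j) <= eps.
Proof.
split=> [/cvg_ballP h eps eps0|h].
  have eps0' : 0 < eps%:C by rewrite ltcR.
  apply: filterS (h _ eps0') => t /mx_ball_normc hb i j.
  by rewrite ltW // hb.
apply/cvg_ballP => e /complex_gt0P[d d0 ->].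
apply: filterS (h _ (divr_gt0 d0 (@ltr0n R 2))) => t ht.
apply/mx_ball_normc => // i j; rewrite (le_lt_trans (ht i j)) //.
by rewrite ltr_pdivrMr // ltr_pMr // ltr1n.
Qed.

Lemma uniform_mx_normc (R : realType) m n (U : choiceType) (D : set U)
    (f : nat -> U -> 'M[R[i]]_(m, n)) (g : U -> 'M[R[i]]_(m, n)) :
  (forall i j (eps : R), 0 < eps -> exists N, forall k t, (N <= k)%N -> D t ->
    normc (g t i j - f k t i j) <= eps) ->
  {uniform D, f @ \oo --> g}.
Proof.
move=> h P /uniform_nbhs[E [entE EP]].
move: entE; rewrite -entourage_ballE => -[e /= /complex_gt0P[d d0 ->] dE].
have hd : \forall k \near \oo, forall i j t, D t ->
    normc (g t i j - f k t i j) <= d / 2.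
  apply: filter_forall => i; apply: filter_forall => j.
  have [N hN] := h i j _ (divr_gt0 d0 (@ltr0n R 2)).
  by exists N => // k Nk t Dt; exact: hN.
apply: filterS hd => k hk; apply: EP => t Dt; apply: dE => /=.
apply/mx_ball_normc => // i j; rewrite (le_lt_trans (hk i j t Dt)) //.
by rewrite ltr_pdivrMr // ltr_pMr // ltr1n.
Qed.

Lemma uniform_ucauchy (R : realType) (U : choiceType) (D : set U)
    (f : nat -> U -> R[i]) (g : U -> R[i]) :
  {uniform D, f @ \oo --> g} -> ucauchy D f.
Proof.
move=> h; apply: ucauchy_base => eps eps0.
have e0 : 0 < (eps / 2)%:C by rewrite ltcR divr_gt0.
pose E : set (R[i] * R[i]) := [set xy | ball xy.1 (eps / 2)%:C xy.2].
have : nbhs (g : {uniform` D -> R[i]}) [set k | forall t, D t -> E (g t, k t)].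
  apply/uniform_nbhs; exists E; split=> //.
  by rewrite -entourage_ballE; exists (eps / 2)%:C.
move=> /h[N _ hN]; exists N => n t Nn Dt.
rewrite -(subrKA (g t)) (le_trans (le_normcD _ _)) // [normc (f n t - _)]normcB.
have hl k : (N <= k)%N -> normc (g t - f k t) <= eps / 2.
  by move=> Nk; have := hN k Nk t Dt; rewrite /E /ball /= normr_normc ltcR => /ltW.
by rewrite [leRHS]splitr lerD ?hl.
Qed.

(** A single sequence is viewed as a family over [unit], so that the uniform estimates also cover
    the case without parameter. *)
Lemma cvgn_ucauchy (R : realType) (z : nat -> R[i]) :
  cvgn z -> ucauchy [set: unit] (fun n _ => z n).
Proof.
move=> /cvg_ex[/= l /cvg_ballP hl]; apply: ucauchy_base => eps eps0.
have e0 : 0 < (eps / 2)%:C by rewrite ltcR divr_gt0.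
have [N _ hN] := hl _ e0; exists N => n _ Nn _.
have hl' k : (N <= k)%N -> normc (l - z k) <= eps / 2.
  by move=> Nk; have := hN k Nk; rewrite /ball /= normr_normc ltcR => /ltW.
rewrite -(subrKA l) (le_trans (le_normcD _ _)) // [normc (z n - _)]normcB.
by rewrite [leRHS]splitr lerD ?hl'.
Qed.

Lemma continuous_mx_coord (R : realType) (T : topologicalType) m n
    (f : T -> 'M[R[i]]_(m, n)) :
  continuous f <-> forall i j, continuous (fun t => f t i j : R[i]).
Proof.
split=> [cf i j t|cf t].
  by move: (cf t) => /(@cvg_mx_normcP R m n _ _ (nbhs_filter t)) h;
    apply/cvg_ballP => e /complex_gt0P[d d0 ->];
    apply: filterS (h _ (divr_gt0 d0 (@ltr0n R 2))) => s /(_ i j) hs;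
    rewrite /ball /= normr_normc ltcR (le_lt_trans hs) // ltr_pdivrMr // ltr_pMr // ltr1n.
apply/cvg_mx_normcP => eps eps0.
apply: filter_forall => i; apply: filter_forall => j.
have e0 : 0 < eps%:C by rewrite ltcR.
move/cvg_ballP: (cf i j t) => /(_ _ e0); apply: filterS => s.
by rewrite /ball /= normr_normc ltcR => /ltW.
Qed.

(** * Continuity of the finite products in the parameter *)

Lemma continuous_mulc (R : realType) (T : topologicalType) (f g : T -> R[i]) :
  continuous f -> continuous g -> continuous (fun t => f t * g t).
Proof.
move=> cf cg t; apply: (@continuousM (R[i] : numFieldType) T f g t).
  exact: cf.
exact: cg.
Qed.

Lemma continuous_sumc (R : realType) (T : topologicalType) (I : Type) (s : seq I)
    (f : I -> T -> R[i]) :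
  (forall k, continuous (f k)) -> continuous (fun t => \sum_(k <- s) f k t).
Proof.
move=> cf; elim: s => [|k s IH].
  by under eq_fun do rewrite big_nil; move=> t; exact: cvg_cst.
under eq_fun do rewrite big_cons.
move=> t; apply: (@continuousD _ R[i] T (f k) (fun t => \sum_(k <- s) f k t)).
  exact: cf.
exact: IH.
Qed.

Lemma continuous_leftprod (R : realType) (T : topologicalType) d
    (B : nat -> T -> 'M[R[i]]_d) (N : nat) :
  (forall n, continuous (B n)) -> continuous (fun t => leftprod (B^~ t) N).
Proof.
move=> cB; elim: N => [|N IH] /=; first by move=> t; exact: cvg_cst.
apply/continuous_mx_coord => i j.
under eq_fun do rewrite mxE.
apply: continuous_sumc => k; apply: continuous_mulc.
  exact: ((continuous_mx_coord _).1 (cB N)).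
exact: ((continuous_mx_coord _).1 IH).
Qed.

Lemma continuous_normalized_prod (R : realType) (T : topologicalType) d alpha
    (B : nat -> T -> 'M[R[i]]_d) (N : nat) :
  (forall n, continuous (B n)) ->
  continuous (fun t => normalized_prod alpha (B^~ t) N).
Proof.
move=> /(@continuous_leftprod _ _ _ _ N)/continuous_mx_coord cB.
apply/continuous_mx_coord => i j; rewrite /normalized_prod.
under eq_fun do rewrite mxE.
by apply: continuous_mulc => //; move=> t; exact: cvg_cst.
Qed.

(** * Scalar multiples, entrywise bounds and the recursion for the normalized products *)

Lemma ucauchyZ (R : rcfType) (U : Type) (D : set U) (c : R[i])
    (f : nat -> U -> R[i]) : ucauchy D f -> ucauchy D (fun n t => c * f n t).
Proof.
move=> cf eps eps0; have c1 : 0 < normc c + 1 by rewrite ltr_wpDl // normc_ge0.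
have [N hN] := cf _ (divr_gt0 eps0 c1); exists N => n k t Nn Nk Dt.
rewrite -mulrBr Normc.normcM (le_trans (ler_wpM2l _ (hN n k t Nn Nk Dt))) ?normc_ge0 //.
by rewrite mulrCA ger_pMr // ler_pdivrMr // mul1r lerDl.
Qed.

Lemma mx_normc_bounded (R : rcfType) m n (M : 'M[R[i]]_(m, n)) :
  exists2 C : R, 0 <= C & forall i j, normc (M i j) <= C.
Proof.
have s0 i : 0 <= \sum_j normc (M i j) by rewrite sumr_ge0 // => j _; exact: normc_ge0.
exists (\sum_i \sum_j normc (M i j)) => [|i j]; first by rewrite sumr_ge0.
rewrite (bigD1 i) //= (bigD1 j) //= -addrA lerDl addr_ge0 ?sumr_ge0 // => k _.
exact: normc_ge0.
Qed.

Lemma normc_mulmx_le (R : rcfType) m n p (M : 'M[R[i]]_(m, n)) (N : 'M[R[i]]_(n, p))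
    (C K : R) :
  (forall i j, normc (M i j) <= C) -> (forall i j, normc (N i j) <= K) ->
  forall i j, normc ((M *m N) i j) <= C * K *+ n.
Proof.
move=> hM hN i j; rewrite mxE (le_trans (ler_normc_sum _ _)) //.
rewrite -[n in leRHS]card_ord -sumr_const ler_sum // => k _.
by rewrite Normc.normcM ler_pM ?normc_ge0.
Qed.

Lemma normalized_prodS (R : realType) d alpha (B : nat -> 'M[R[i]]_d) N :
  normalized_prod alpha B N.+1 = alpha%:C^-1 *: (B N *m normalized_prod alpha B N).
Proof. by rewrite /normalized_prod /= exprS invfM -scalerA -scalemxAr. Qed.

Lemma mulmx2E (R : pzSemiRingType) (m p : nat) (M : 'M[R]_(m, 2)) (N : 'M[R]_(2, p)) i j :
  (M *m N) i j = M i 0 * N 0 j + M i 1 * N 1 j.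
Proof.
rewrite mxE big_ord_recl big_ord1 (_ : lift ord0 ord0 = 1) //.
exact/val_inj.
Qed.

(** * Reduction of the matrix products to the perturbed diagonal system *)

Section NormalizedProducts.
Variables (R : realType) (A : 'M[R[i]]_2) (alpha : R) (lambda : R[i]).
Hypotheses (A_lambda : eigenvalue A lambda) (alpha_gt0 : 0 < alpha).
Hypothesis lambda_lt : `|lambda| < alpha%:C.
Variables r l : 'cV[R[i]]_2.
Hypotheses (r_eigen : A *m r = alpha%:C *: r) (l_eigen : l^T *m A = alpha%:C *: l^T).
Hypothesis lr_neq0 : (l^T *m r) ord0 ord0 <> 0.

Let alphaC0 : alpha%:C != 0 :> R[i].
Proof. by apply/eqP => -[] a0; move: alpha_gt0; rewrite a0 ltxx. Qed.

Let c := (l^T *m r) ord0 ord0.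

(** The rows of [P] are [l^T] and a left eigenvector [v] for [lambda]. As [v *m r = 0], [P] sends
    [r] to [c] times the first basis vector, so the first column of [invmx P] is [c^-1 *: r], which
    gives the corner entry. *)
Lemma left_diagonalization : exists P : 'M[R[i]]_2, [/\ P \in unitmx,
  P *m A = diag_mx (\row_k (if k == 0 then alpha%:C else lambda)) *m P &
  forall E : 'M[R[i]]_2,
    (P *m E *m invmx P) 0 0 = c^-1 * (l^T *m E *m r) ord0 ord0].
Proof.
have /eigenvalueP[v vA v0] := A_lambda.
have c0 : c != 0 by apply/eqP.
have al : alpha%:C != lambda.
  apply/eqP => al; move: lambda_lt.
  by rewrite -al normr_normc normc_real ger0_norm ?ltxx // ltW.
(* Evaluating [v *m A *m r] from both sides gives [alpha] and [lambda] times [v *m r], and these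
   eigenvalues differ. *)
have vr : v *m r = 0.
  have : alpha%:C *: (v *m r) = lambda *: (v *m r).
    by rewrite [RHS]scalemxAl -vA -mulmxA r_eigen scalemxAr.
  move/eqP; rewrite -subr_eq0 -scalerBl scaler_eq0 subr_eq0 (negPf al) /=.
  by move/eqP.
have lr : l^T *m r = c%:M by rewrite [LHS]mx11_scalar.
pose P : 'M[R[i]]_2 := \matrix_k (if k == 0 then l^T else v).
have Pr : P *m r = c *: delta_mx 0 0.
  apply/row_matrixP => k; rewrite row_mul rowK.
  case: ifP => [/eqP ->|k0]; last first.
    by rewrite vr; apply/rowP => j; rewrite !mxE k0 mulr0.
  by rewrite lr; apply/rowP => j; rewrite ord1 !mxE /= mulr1.
have uP : P \in unitmx.
  rewrite -row_free_unit; apply: inj_row_free => u uP0.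
  move: (uP0); rewrite mulmx_sum_row big_ord_recl big_ord1 !rowK /= => uE.
  (* Multiplying the relation between the rows by [r] removes [v] and leaves [c] times the first
     coefficient. *)
  have u0 : u 0 ord0 = 0.
    have := congr1 (mulmx^~ r) uE.
    rewrite /= mulmxDl -!scalemxAl vr lr mul0mx scaler0 addr0 scale_scalar_mx.
    by move=> /matrixP/(_ 0 0); rewrite !mxE /= mulr1n => /eqP;
      rewrite mulf_eq0 (negPf c0) orbF => /eqP.
  move: uE; rewrite u0 scale0r add0r => /eqP; rewrite scaler_eq0 (negPf v0) orbF.
  move=> /eqP u1; apply/rowP => k; rewrite mxE.
  by case: (unliftP ord0 k) => [j|] -> //; rewrite ord1.
exists P; split=> //.
  apply/row_matrixP => k; rewrite !row_mul row_diag_mx -scalemxAl -rowE !rowK.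
  by rewrite mxE; case: ifP => _; rewrite ?l_eigen ?vA.
move=> E.
have e0 : invmx P *m delta_mx 0 0 = c^-1 *: r :> 'cV_2.
  by rewrite -[r](mulKmx uP) Pr -scalemxAr scalerA mulVf // scale1r.
have -> : (P *m E *m invmx P) 0 0 = (P *m E *m (invmx P *m delta_mx 0 (0 : 'I_1))) 0 0.
  by rewrite mulmxA -colE !mxE.
rewrite e0 -scalemxAr mxE; congr (_ * _).
transitivity ((row 0 P *m (E *m r)) 0 0); last by rewrite rowK /= mulmxA.
by rewrite -row_mul [RHS]mxE mulmxA.
Qed.

Variables (nu : 'M[R[i]]_2 -> R) (nu_norm : matrix_norm nu).

(** Each column of [P] times the normalized product solves the perturbed system with
    [mu = lambda / alpha]. Its coefficient [a] is the corner entry [F n t 0 0], a fixed multiple of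
    [l^T E r], so only that series has to converge. *)
Lemma normalized_prod_ucauchy (U : Type) (D : set U) (An : nat -> U -> 'M[R[i]]_2)
    (s : nat -> R) (B : R) :
  (forall n, 0 <= s n) -> (forall N, \sum_(0 <= k < N) s k <= B) ->
  (forall n t, D t -> nu (An n t - A) ^+ 2 <= s n) ->
  ucauchy D (fun N t => \sum_(0 <= n < N) (l^T *m (An n t - A) *m r) ord0 ord0) ->
  forall i j, ucauchy D (fun N t => normalized_prod alpha (An^~ t) N i j).
Proof.
move=> s0 sB hs cS.
have [P [uP PA P00]] := left_diagonalization.
have [Cn Cn0 hCn] := matrix_norm_coord nu_norm.
have [CP CP0 hCP] := mx_normc_bounded P.
have [CQ CQ0 hCQ] := mx_normc_bounded (invmx P).
have [nu_ge0 _ _ _] := nu_norm.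
pose F n t := alpha%:C^-1 *: (P *m (An n t - A) *m invmx P).
(* Entries of [P], of the perturbation and of [invmx P] are bounded by [CP], [Cn * Num.sqrt (s n)]
   and [CQ]; each [*+ 2] comes from one product of 2 by 2 matrices. *)
pose K := `|alpha^-1| * ((CP * Cn *+ 2) * CQ *+ 2).
have K0 : 0 <= K by rewrite mulr_ge0 // mulrn_wge0 // mulr_ge0 // mulrn_wge0 // mulr_ge0.
pose e n := K * Num.sqrt (s n).
have e0 n : 0 <= e n by rewrite mulr_ge0 // sqrtr_ge0.
have eB N : \sum_(0 <= k < N) e k ^+ 2 <= K ^+ 2 * B.
  under eq_bigr do rewrite exprMn sqr_sqrtr //.
  by rewrite -mulr_sumr ler_wpM2l ?sqr_ge0.
have Fe n t i j : D t -> normc (F n t i j) <= e n.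
  move=> Dt; rewrite /F mxE Normc.normcM -fmorphV normc_real /e /K -mulrA.
  rewrite ler_wpM2l //.
  have En k k' : normc ((An n t - A) k k') <= Cn * Num.sqrt (s n).
    rewrite (le_trans (hCn _ _ _)) // ler_wpM2l //.
    by rewrite -[leLHS]ger0_norm // -sqrtr_sqr ler_wsqrtr // hs.
  rewrite (le_trans (normc_mulmx_le (normc_mulmx_le hCP En) hCQ i j)) //.
  by rewrite le_eqVlt; apply/orP; left; apply/eqP; ring.
pose Y j n t (k : 'I_2) := (P *m normalized_prod alpha (An^~ t) n) k j.
have YS j n t k : Y j n.+1 t k =
    alpha%:C^-1 * (if k == 0 then alpha%:C else lambda) * Y j n t k +
    (F n t k 0 * Y j n t 0 + F n t k 1 * Y j n t 1).
  rewrite /Y normalized_prodS -scalemxAr.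
  have -> : P *m (An n t *m normalized_prod alpha (An^~ t) n) =
      diag_mx (\row_k0 (if k0 == 0 then alpha%:C else lambda)) *m
        (P *m normalized_prod alpha (An^~ t) n) +
      P *m (An n t - A) *m invmx P *m (P *m normalized_prod alpha (An^~ t) n).
    rewrite [in RHS]mulmxA -PA -[in X in _ + X]mulmxA mulKmx //.
    by rewrite -!mulmxA -mulmxDr -mulmxDl [A + _]addrC subrK.
  rewrite scalerDr mxE; congr (_ + _).
    by rewrite mul_diag_mx !mxE -mulrA.
  by rewrite scalemxAl [LHS]mulmx2E.
have cY j k : ucauchy D (fun n t => Y j n t k).
  have mu1 : normc (alpha%:C^-1 * lambda) < 1.
    rewrite Normc.normcM -fmorphV normc_real ger0_norm ?invr_ge0 ?(ltW alpha_gt0) //.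
    rewrite mulrC ltr_pdivrMr // mul1r.
    by move: lambda_lt; rewrite normr_normc ltcR.
  have cS' : ucauchy D (fun N t => \sum_(0 <= n < N) F n t 0 0).
    have -> : (fun N t => \sum_(0 <= n < N) F n t 0 0) =
        (fun N t => alpha%:C^-1 * c^-1 *
          \sum_(0 <= n < N) (l^T *m (An n t - A) *m r) ord0 ord0).
      apply/funext => N; apply/funext => t; rewrite mulr_sumr.
      by apply: eq_bigr => n _; rewrite /F mxE P00 mulrA.
    exact: ucauchyZ.
  have Y0 (k' : 'I_2) t : D t -> normc (Y j 0 t k') <= CP.
    by move=> _; rewrite /Y /normalized_prod expr0 invr1 scale1r mulmx1.
  have xS n t : D t -> Y j n.+1 t 0 =
      (1 + F n t 0 0) * Y j n t 0 + F n t 0 1 * Y j n t 1.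
    by move=> _; rewrite YS eqxx mulVf // mulrDl addrA.
  have yS n t : D t -> Y j n.+1 t 1 =
      F n t 1 0 * Y j n t 0 + (alpha%:C^-1 * lambda + F n t 1 1) * Y j n t 1.
    by move=> _; rewrite YS [RHS]addrC mulrDl -addrA [F n t 1 1 * _ + _]addrC.
  have [cY0 cY1 _ _] := @perturbed_system_ucauchy R U D _ _ e _ _ _ _
    (fun n t => Y j n t 0) (fun n t => Y j n t 1) mu1 e0 eB
    (fun n t => @Fe n t 0 0) (fun n t => @Fe n t 0 1) (fun n t => @Fe n t 1 0)
    (fun n t => @Fe n t 1 1) cS' CP (Y0 0) (Y0 1) xS yS.
  by case: (unliftP ord0 k) => [k'|] -> //; rewrite (_ : lift _ _ = 1) //;
    apply/val_inj; rewrite /= ord1.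
move=> i j.
(* Multiplying by [invmx P] returns to the original coordinates. *)
have -> : (fun N t => normalized_prod alpha (An^~ t) N i j) =
    (fun N t => invmx P i 0 * Y j N t 0 + invmx P i 1 * Y j N t 1).
  apply/funext => N; apply/funext => t.
  by rewrite -mulmx2E mulKmx.
by apply: ucauchyD; apply: ucauchyZ.
Qed.

End NormalizedProducts.

(** * From extended real series to real bounds, and proof of the theorem *)

Lemma nneseries_partial_sums_bounded (R : realType) (u : nat -> \bar R) :
  (forall n, (0 <= u n)%E) -> (\sum_(0 <= n <oo) u n < +oo)%E ->
  exists (s : nat -> R) (B : R), [/\ forall n, u n = (s n)%:E,
    forall n, 0 <= s n & forall N, \sum_(0 <= k < N) s k <= B].
Proof.
move=> u0 uoo.
have le N : (\sum_(0 <= k < N) u k <= \sum_(0 <= n <oo) u n)%E.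
  exact: nneseries_lim_ge.
have uk n : (u n < +oo)%E.
  apply: le_lt_trans uoo; apply: le_trans (le n.+1).
  by rewrite big_nat_recr //= leeDr // sume_ge0.
have uE n : u n = (fine (u n))%:E.
  by rewrite fineK // ge0_fin_numE.
exists (fine \o u), (fine (\sum_(0 <= n <oo) u n)%E); split=> // [n|N].
  by rewrite fine_ge0.
have tot0 : (0 <= \sum_(0 <= n <oo) u n)%E by apply: le_trans (le 0); rewrite big_geq.
rewrite -lee_fin fineK ?ge0_fin_numE // -sumEFin.
by under eq_bigr do rewrite /= -uE.
Qed.

Theorem proposition3p3 (R : realType) (A : 'M[R[i]]_2)
    (alpha : R) (lambda : R[i])
    (A_diag : diagonalizable A)
    (A_alpha : eigenvalue A alpha%:C) (A_lambda : eigenvalue A lambda)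
    (alpha_gt0 : 0 < alpha) (lambda_lt : `|lambda| < alpha%:C)
    (r l : 'cV[R[i]]_2)
    (r_eigen : A *m r = alpha%:C *: r)
    (l_eigen : l^T *m A = alpha%:C *: l^T)
    (lr_neq0 : (l^T *m r) ord0 ord0 <> 0)
    (nu : 'M[R[i]]_2 -> R) (nu_norm : matrix_norm nu) :
  (forall An : nat -> 'M[R[i]]_2,
     let E n := An n - A in
     (\sum_(0 <= n <oo) (nu (E n) ^+ 2)%:E < +oo)%E ->
     cvgn (fun N => \sum_(0 <= n < N) (l^T *m E n *m r) ord0 ord0) ->
     cvgn (normalized_prod alpha An))
  /\
  (forall An : nat -> R -> 'M[R[i]]_2,
     let E n t := An n t - A in
     (forall n, continuous (An n)) ->
     (forall T : R, 0 < T ->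
        (\sum_(0 <= n <oo)
           ereal_sup [set (nu (E n t) ^+ 2)%:E | t in [set t : R | (`|t| <= T)%R]]
         < +oo)%E
        /\
        cvg_uniformly_on [set t : R | `|t| <= T]
          (fun N t => \sum_(0 <= n < N) (l^T *m E n t *m r) ord0 ord0)) ->
     exists2 L : R -> 'M[R[i]]_2,
       cvg_locally_uniformly_to
         (fun N t => normalized_prod alpha (An^~ t) N) L
       & continuous L).

Proof.
have nu0 := mxnorm_ge0 nu_norm.
have key := @normalized_prod_ucauchy R A alpha lambda A_lambda alpha_gt0 lambda_lt
  r l r_eigen l_eigen lr_neq0 nu nu_norm.
split=> [An E sE cE|An E cA hE].
  have [n||s [B [sn s0 sB]]] := @nneseries_partial_sums_bounded R
    (fun n => (nu (E n) ^+ 2)%:E).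
  - by rewrite lee_fin sqr_ge0.
  - exact: sE.
  (* The constant family over [unit]; the [eq_ind] term turns the equality [sn n] into the required
     bound by [s n]. *)
  have cP := key unit setT (fun n _ => An n) s B s0 sB
    (fun n _ _ => eq_ind _ (fun x => x <= s n) (lexx _) _ (esym (EFin_inj (sn n))))
    (cvgn_ucauchy cE).
  apply/cvg_ex; exists (\matrix_(i, j) clim (fun N => normalized_prod alpha An N i j)).
  apply/cvg_mx_normcP => eps eps0.
  apply: filter_forall => i; apply: filter_forall => j.
  have [N hN] := ucauchy_clim (cP i j) eps0.
  by exists N => // n Nn; rewrite mxE; exact: (hN n tt).
pose L t : 'M[R[i]]_2 :=
  \matrix_(i, j) clim (fun N => normalized_prod alpha (An^~ t) N i j).
have uL (x : R) : {uniform (ball x (1 : R)),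
    (fun N t => normalized_prod alpha (An^~ t) N) @ \oo --> L}.
  (* The unit ball around [x] lies in the set where [t] has absolute value at most this [T]. *)
  have T0 : 0 < `|x| + 1 by rewrite ltr_wpDl.
  have [sE [g cS]] := hE _ T0.
  set D := [set t : R | `|t| <= `|x| + 1] in sE cS *.
  have [n||s [B [sn s0 sB]]] := @nneseries_partial_sums_bounded R
    (fun n => ereal_sup [set (nu (E n t) ^+ 2)%:E | t in D]).
  (* The supremum is nonnegative because [D] contains 0; over an empty set it would be [-oo]. *)
  - apply: (@le_trans _ _ (nu (E n 0) ^+ 2)%:E); first by rewrite lee_fin sqr_ge0.
    by apply: ereal_sup_ubound; exists 0 => //; rewrite /D /= normr0 ltW.
  - exact: sE.
  have hs n t : D t -> nu (An n t - A) ^+ 2 <= s n.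
    by move=> Dt; rewrite -lee_fin -sn; apply: ereal_sup_ubound; exists t.
  have cP := key R D An s B s0 sB hs (uniform_ucauchy cS).
  apply: uniform_mx_normc => i j eps eps0.
  have [N hN] := ucauchy_clim (cP i j) eps0.
  exists N => k t Nk xt; rewrite mxE; apply: hN => //.
  move: xt; rewrite /D /ball /= => xt.
  rewrite -[t](subrK x) [leRHS]addrC (le_trans (ler_normD _ _)) // lerD2r.
  by rewrite distrC ltW.
exists L => [x|x].
  exists (ball x (1 : R)); first exact: nbhsx_ballx.
  exact: uL.
(* A uniform limit of continuous functions is continuous on the ball, and openness of the ball turns
   this into continuity at [x]. *)
have : {within ball x (1 : R), continuous L}.
  apply: (uniform_limit_continuous_subspace _ _ (uL x)).
  by exists 0 => // N _; apply: continuous_subspaceT;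
    exact: (@continuous_normalized_prod R R 2 alpha An N cA).
rewrite continuous_open_subspace; last exact: ball_open.
by apply; rewrite inE; exact: ballxx.
Qed.
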